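(* For all positive integers $k,N$, \[\frac{1}{k}\,G'_{1/[k]}(N)\le F'_k(N)\le k\,G'_{1/[k]}(N).\] In particular $\lim_{k\to\infty}\lim_{N\to\infty}\log G'_{1/[k]}(N)/\log N=1$ if and only if $\lim_{k\to\infty}\lim_{N\to\infty}\log F'_{k}(N)/\log N=1$.
   Context: Let $1/[k]=\{1/i:1\le i\le k\}$. A $U$-pattern with basepoint $x$ and nonzero scaling factor $r$ is $x+r\cdot U$. $G'_{1/[k]}(N)$ is the size of the smallest set of rational numbers that contains a $1/[k]$-pattern with basepoint $a$ for $N$ distinct integer values of $a$. $F'_k(N)$ is the size of the smallest set of integers containing a $k$-term arithmetic progression with common difference $d$ for $N$ distinct integer values of $d$. *)

(* Defs.v *)
From mathcomp Require Import all_boot all_order all_algebra.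
From mathcomp Require Import finmap.
From mathcomp Require Import all_classical all_reals all_analysis.

Set Implicit Arguments.
Unset Strict Implicit.
Unset Printing Implicit Defensive.

Import Order.TTheory GRing.Theory Num.Theory.
Import numFieldNormedType.Exports.
Local Open Scope fset_scope.
Local Open Scope ring_scope.

Definition inv_upto (k : nat) : {fset rat} :=
  [fset (i%:R : rat)^-1 | i in iota 1 k].

Definition pattern (U : {fset rat}) (x r : rat) : {fset rat} :=
  [fset x + r * u | u in U].

Definition arith_prog (k : nat) (b d : int) : {fset int} :=
  [fset b + d *+ i | i in iota 0 k].

Definition has_pattern (U : {fset rat}) (A : {fset rat}) (x : rat) : Prop :=
  exists2 r : rat, r != 0 & pattern U x r `<=` A.

(* As for patterns, the scaling factor d is nonzero: a constant sequence is
   not counted as an arithmetic progression. *)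
Definition has_AP (k : nat) (A : {fset int}) (d : int) : Prop :=
  d != 0 /\ exists b : int, arith_prog k b d `<=` A.

Definition pattern_rich (U : {fset rat}) (N : nat) (A : {fset rat}) : Prop :=
  exists2 D : {fset int}, #|` D| = N &
    forall a : int, a \in D -> has_pattern U A a%:~R.

Definition AP_rich (k N : nat) (A : {fset int}) : Prop :=
  exists2 D : {fset int}, #|` D| = N & forall d : int, d \in D -> has_AP k A d.

Definition pattern_rich_card (U : {fset rat}) (N : nat) : pred nat :=
  fun n => `[< exists2 A, pattern_rich U N A & #|` A| = n >].

Definition AP_rich_card (k N : nat) : pred nat :=
  fun n => `[< exists2 A, AP_rich k N A & #|` A| = n >].

Lemma card_Posz_succ (N : nat) : #|` [fset (i.+1%:Z : int) | i in iota 0 N]| = N.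
Proof.
rewrite card_imfset /=; last by move=> i j [].
by rewrite undup_id ?iota_uniq // size_iota.
Qed.

Lemma pattern_rich_card_ex (U : {fset rat}) (N : nat) :
  exists n, pattern_rich_card U N n.
Proof.
pose A : {fset rat} := [fset ((i.+1%:Z)%:~R + u : rat) | i in iota 0 N, u in U].
exists #|` A|; apply/asboolP; exists A => //.
exists [fset (i.+1%:Z : int) | i in iota 0 N]; first exact: card_Posz_succ.
move=> a /imfsetP [i /= iN ->]; exists 1; first exact: oner_neq0.
apply/fsubsetP => x /imfsetP [u /= uU ->]; rewrite mul1r.
by apply/imfset2P; exists i => //; exists u.
Qed.

Lemma AP_rich_card_ex (k N : nat) : exists n, AP_rich_card k N n.
Proof.
pose A : {fset int} := [fset 0 + (i.+1%:Z : int) *+ j | i in iota 0 N, j in iota 0 k].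
exists #|` A|; apply/asboolP; exists A => //.
exists [fset (i.+1%:Z : int) | i in iota 0 N]; first exact: card_Posz_succ.
move=> d /imfsetP [i /= iN ->]; split=> //; exists 0.
apply/fsubsetP => x /imfsetP [j /= jk ->].
by apply/imfset2P; exists i => //; exists j.
Qed.

Definition G' (U : {fset rat}) (N : nat) : nat :=
  ex_minn (pattern_rich_card_ex U N).

Definition F' (k N : nat) : nat := ex_minn (AP_rich_card_ex k N).

(* lim_{k -> oo} lim_{N -> oo} u k N = l, including the existence of the inner
   limit for every k >= 1. *)
Definition iterated_lim_is (R : realType) (u : nat -> nat -> R) (l : R) : Prop :=
  exists2 v : nat -> R,
    forall k, (0 < k)%N -> (u k N @[N --> \oo] --> v k)%classic &
    (v k @[k --> \oo] --> l)%classic.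

(* Main.v *)
(** A progression [b + d * i] with [0 <= i < k] turns into the [1/[k]]-pattern
    with basepoint [d] and scaling factor [b - d] when its term of index [i] is
    divided by [i + 1].  Conversely, multiplying the element [a + r / i] of a
    pattern by [i] gives the progression [r + a * i]; since its difference is
    an integer, it survives taking integer parts.  Both operations multiply the
    size of the ambient set by at most [k], and a preliminary translation makes
    the scaling factors, respectively the differences, nonzero.  The logarithms
    of [F' k N] and [G' (inv_upto k) N] thus differ by at most [ln k], which is
    negligible against [ln N]. *)

Require Import Defs.
From mathcomp Require Import all_boot all_order all_algebra.
From mathcomp Require Import finmap ring.
From mathcomp Require Import all_classical all_reals all_analysis.

Import Order.TTheory GRing.Theory Num.Theory.
Import numFieldNormedType.Exports.
Local Open Scope ring_scope.

Lemma G'_min (U : {fset rat}) (N : nat) (A : {fset rat}) :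
  pattern_rich U N A -> (G' U N <= #|` A|)%N.
Proof.
move=> HA; rewrite /G'; case: ex_minnP => m _; apply.
by apply/asboolP; exists A.
Qed.

Lemma G'_attained (U : {fset rat}) (N : nat) :
  exists2 A, pattern_rich U N A & #|` A| = G' U N.
Proof. by rewrite /G'; case: ex_minnP => m /asboolP. Qed.

Lemma F'_min (k N : nat) (A : {fset int}) :
  AP_rich k N A -> (F' k N <= #|` A|)%N.
Proof.
move=> HA; rewrite /F'; case: ex_minnP => m _; apply.
by apply/asboolP; exists A.
Qed.

Lemma F'_attained (k N : nat) :
  exists2 A, AP_rich k N A & #|` A| = F' k N.
Proof. by rewrite /F'; case: ex_minnP => m /asboolP. Qed.

Lemma card_fset_allpairs (S T : eqType) (K : choiceType) (f : S -> T -> K)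
    (s : seq S) (t : seq T) :
  (#|` [fset y in [seq f i x | i <- s, x <- t]]%fset| <= size s * size t)%N.
Proof.
apply: leq_trans (leq_imfset_card _ _ _) _.
by rewrite /= (leq_trans (size_undup _)) // size_allpairs.
Qed.

(** The sum of the absolute values of the entries, plus one, exceeds every entry. *)
Lemma exists_int_notin (s : seq int) : exists t : int, t \notin s.
Proof.
have bnd : forall x, x \in s -> x <= \sum_(y <- s) `|y|.
  elim: s => // y s IHs x; rewrite inE big_cons => /predU1P[->|/IHs xs].
    by rewrite (le_trans (ler_norm y)) // lerDl sumr_ge0.
  by rewrite (le_trans xs) // lerDr.
exists (\sum_(y <- s) `|y| + 1); apply/negP => /bnd.
by rewrite gerDl ler10.
Qed.

Lemma G'_le_F' (k N : nat) : (0 < k)%N ->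
  (G' (inv_upto k) N <= k * F' k N)%N.
Proof.
move=> k0; have [A [D cD AP_D] <-] := F'_attained k N.
(* Translating [A] by [t] makes the scaling factor [b + t - d] nonzero for all [d] in [D] and [b] in
   [A] at once. *)
have [t tP] := exists_int_notin
  [seq d - x | d <- (D : seq int), x <- (A : seq int)].
pose B := [fset y in [seq ((x + t)%:~R / i%:R : rat)
                     | i <- iota 1 k, x <- (A : seq int)]]%fset.
apply: (@leq_trans #|` B|); last first.
  by rewrite (leq_trans (card_fset_allpairs _ _ _ _ _ _)) // size_iota.
apply: G'_min; exists D => // d dD; have [_ [b /fsubsetP bA]] := AP_D d dD.
have bdA i : (i < k)%N -> b + d *+ i \in A.
  by move=> ik; apply: bA; apply/imfsetP; exists i => //=; rewrite mem_iota.
exists (b + t - d)%:~R.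
  rewrite intr_eq0 subr_eq0; apply: contraNneq tP => btd.
  apply/allpairsP; exists (d, b) => /=; split => //.
    (* As [k] is positive, the progression has a term of index 0, so [b] itself lies in [A]. *)
    by have := bdA 0%N k0; rewrite mulr0n addr0.
  by rewrite -btd addrAC subrr add0r.
apply/fsubsetP => x /imfsetP[u /= /imfsetP[i /=]].
rewrite mem_iota add1n ltnS => /andP[i0 ik] -> ->.
(* Pattern indices start at 1 and progression indices at 0: [d + (b + t - d) / i = (b + d * (i - 1)
   + t) / i]. *)
rewrite in_fset; apply/allpairsP; exists (i, b + d *+ i.-1) => /=; split.
- by rewrite mem_iota i0 add1n ltnS.
- by apply: bdA; rewrite prednK.
- have inz : (i%:R : rat) != 0 by rewrite pnatr_eq0 -lt0n.
  have -> : b + d *+ i.-1 = b - d + d *+ i.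
    by rewrite -{2}(prednK i0) mulrS; ring.
  by rewrite !rmorphD !rmorphN rmorphMn -mulr_natr /=; field.
Qed.

Lemma F'_le_G' (k N : nat) :
  (F' k N <= k * G' (inv_upto k) N)%N.
Proof.
have [A [D cD pat_D] <-] := G'_attained (inv_upto k) N.
(* Basepoints become differences, so they are shifted by [t] to avoid 0. *)
have [t tP] := exists_int_notin [seq - a | a <- (D : seq int)].
pose B := [fset y in [seq Num.floor (i%:R * (x + t%:~R))
                     | i <- iota 1 k, x <- (A : seq rat)]]%fset.
apply: (@leq_trans #|` B|); last first.
  by rewrite (leq_trans (card_fset_allpairs _ _ _ _ _ _)) // size_iota.
apply: F'_min; exists [fset (a + t)%R | a in D]%fset.
  by rewrite card_imfset //=; apply: addIr.
move=> _ /imfsetP[a /= aD ->]; have [r r0 /fsubsetP rA] := pat_D a aD.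
split.
  apply: contraNneq tP => /eqP; rewrite addrC addr_eq0 => /eqP ->.
  by rewrite map_f.
(* The rational progression starts at [i = 1] with [r + a + t]. Its difference [a + t] is an
   integer, so all terms have the same fractional part and their floors form a progression with that
   difference. *)
exists (Num.floor (r + a%:~R + t%:~R)); apply/fsubsetP => x /imfsetP[j /=].
rewrite mem_iota => /andP[_ jk] ->.
rewrite in_fset; apply/allpairsP.
exists (j.+1, a%:~R + r / j.+1%:R) => /=; split.
- by rewrite mem_iota.
- apply: rA; apply/imfsetP; exists (j.+1%:R^-1) => //=.
  by apply/imfsetP; exists j.+1 => //=; rewrite mem_iota.
- have jnz : (j.+1%:R : rat) != 0 by rewrite pnatr_eq0.
  have -> : j.+1%:R * (a%:~R + r / j.+1%:R + t%:~R) =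
      (r + a%:~R + t%:~R) + ((a + t) *+ j)%:~R :> rat.
    by rewrite rmorphMn rmorphD /= -mulr_natr -natr1; field; rewrite natr1.
  by rewrite [RHS]floorDrz ?intr_int ?intrKfloor.
Qed.

Lemma ln_nat_ratio_le (R : realType) (k p q : nat) : (0 < k)%N ->
  (p <= k * q)%N -> (q <= k * p)%N ->
  `|ln (p%:R : R) - ln (q%:R : R)| <= ln (k%:R : R).
Proof.
move=> k0; have k0R : (k%:R : R) \is Num.pos by rewrite posrE ltr0n.
(* The two bounds force [p] and [q] to vanish together, so logarithms of 0 cancel. *)
case: p => [|p] Hp Hq.
  move: Hq; rewrite muln0 leqn0 => /eqP ->.
  by rewrite subrr normr0 ln_ge0 // ler1n.
case: q => [|q] in Hp Hq *; first by rewrite muln0 in Hp.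
have p0R : (p.+1%:R : R) \is Num.pos by rewrite posrE ltr0n.
have q0R : (q.+1%:R : R) \is Num.pos by rewrite posrE ltr0n.
have mulpos (n : nat) : k%:R * n.+1%:R \is @Num.pos R.
  by rewrite posrE mulr_gt0 ?ltr0n.
rewrite ler_norml lerBlDr -lnM // lerNl opprB lerBlDr -lnM //.
by rewrite !ler_ln // -!natrM !ler_nat Hp Hq.
Qed.

Lemma cvg_ln_nat (R : realType) : (ln (N%:R : R) @[N --> \oo] --> +oo)%classic.
Proof.
apply/cvgryPge => A; near=> N.
rewrite -[leLHS]expRK ler_ln ?posrE ?expR_gt0 //.
  by near: N; exact: nbhs_infty_ger.
by rewrite ltr0n; near: N; exists 1%N.
Unshelve. all: by end_near. Qed.

(** For fixed [k] the two quotients differ by at most [ln k / ln N], which tends to 0, so a squeeze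
    applies. *)
Lemma cvg_ln_ratio (R : realType) (p q : nat -> nat) (k : nat) (l : R) :
  (0 < k)%N ->
  (forall N, (0 < N)%N -> (p N <= k * q N)%N) ->
  (forall N, (0 < N)%N -> (q N <= k * p N)%N) ->
  (ln ((p N)%:R : R) / ln (N%:R : R) @[N --> \oo] --> l)%classic ->
  (ln ((q N)%:R : R) / ln (N%:R : R) @[N --> \oo] --> l)%classic.
Proof.
move=> k0 Hpq Hqp Hp.
have lnV : ((ln (N%:R : R))^-1 @[N --> \oo] --> (0 : R))%classic.
  apply/gtr0_cvgV0; last exact: cvg_ln_nat.
  by near=> N; rewrite ln_gt0 // ltr1n; near: N; exists 2%N.
have lnkV :
    (ln (k%:R : R) * (ln (N%:R : R))^-1 @[N --> \oo] --> (0 : R))%classic.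
  by have := cvgMl_tmp (a := ln k%:R) lnV; rewrite mulr0; apply.
apply: (@squeeze_cvgr _ _ _ _
  (fun N => ln ((p N)%:R : R) / ln (N%:R : R) - ln k%:R * (ln N%:R)^-1)
  (fun N => ln ((p N)%:R : R) / ln (N%:R : R) + ln k%:R * (ln N%:R)^-1)).
- near=> N.
  have N1 : (0 < N)%N by near: N; exists 1%N.
  have : `|ln (q N)%:R - ln (p N)%:R| <= ln (k%:R : R).
    by apply: ln_nat_ratio_le => //; [apply: Hqp | apply: Hpq].
  rewrite ler_distl -mulrBl -mulrDl => /andP[lo hi].
  by rewrite !ler_wpM2r // invr_ge0 ln_ge0 // ler1n.
- by have := cvgB Hp lnkV; rewrite subr0; apply.
- by have := cvgD Hp lnkV; rewrite addr0; apply.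
Unshelve. all: by end_near. Qed.

Theorem mainTheorem7 (R : realType) :
  (forall k N : nat, (0 < k)%N -> (0 < N)%N ->
     (k%:R : R)^-1 * (G' (inv_upto k) N)%:R <= (F' k N)%:R :> R /\
     (F' k N)%:R <= k%:R * (G' (inv_upto k) N)%:R :> R) /\
  (iterated_lim_is
     (fun k N : nat => ln ((G' (inv_upto k) N)%:R : R) / ln (N%:R : R)) 1 <->
   iterated_lim_is
     (fun k N : nat => ln ((F' k N)%:R : R) / ln (N%:R : R)) 1).
Proof.
split=> [k N k0 _|].
  split; last by rewrite -natrM ler_nat F'_le_G'.
  by rewrite mulrC ler_pdivrMr ?ltr0n // mulrC -natrM ler_nat G'_le_F'.
(* For each [k] the inner limits agree, so the same [v] serves both sides and the outer limit
   carries over unchanged. *)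
split=> -[v Hv Hlim]; exists v => // k k0.
- apply: (cvg_ln_ratio _ (G' (inv_upto k)) (F' k) _ _ k0 _ _ (Hv k k0)) => N _.
  + exact: G'_le_F'.
  + exact: F'_le_G'.
- apply: (cvg_ln_ratio _ (F' k) (G' (inv_upto k)) _ _ k0 _ _ (Hv k k0)) => N _.
  + exact: F'_le_G'.
  + exact: G'_le_F'.
Qed.
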